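(* Let $(x^*,y^* )\in S$ and let $(x_k,y_k)_{k\ge 0}$ be a sequence satisfying, for every $k\ge 0$, $$\left\{\begin{array}{rcl} \alpha_k(x_{k+1}-x_k)+\beta_kA^*(y_{k+1}-y_k)+\partial f(x_{k+1})+\nabla F(x_k)+A^*y_{k+1}&\ni&\varepsilon_{k+1},\\ -\beta_kA(x_{k+1}-x_k)+\delta_k(y_{k+1}-y_k)-Ax_{k+1}+\partial g(y_{k+1})+\nabla G(y_k)&\ni&\epsilon_{k+1}, \end{array}\right.$$ where $\varepsilon_{k+1}\in\mathcal X$, $\epsilon_{k+1}\in\mathcal Y$, the sequences $(\alpha_k),(\beta_k),(\delta_k)$ are positive, and there is $\theta\in(0,1)$ such that, for every $k\ge 0$, $$(1-\theta)\alpha_k\ge\frac{(\beta_k+1)L_F}{2\beta_k+1},\quad (1-\theta)\delta_k\ge\frac{(\beta_k+1)L_G}{2\beta_k+1},\quad \frac{\beta_{k+1}}{\alpha_{k+1}}\ge\frac{1+\beta_k}{\alpha_k},\quad \frac{\beta_{k+1}}{\delta_{k+1}}\ge\frac{1+\beta_k}{\delta_k}.$$ Set $B_j:=\prod_{i=0}^j\sqrt{1+\frac1{\beta_i}}$ for $j\ge 0$. Then, for every $k\ge 0$, $$\sqrt{E_{k+1}}\le\frac1{B_k}\left(\sqrt{E_0}+\left(1+\sqrt{1+\frac1{2\theta}}\right)\sum_{j=0}^k\beta_jB_jR_j\right).$$ In particular: (i) If $(1/\beta_k)\notin\ell^1$ and $(\beta_kR_k)\in\ell^1$, then $\lim_{k\to\infty}\Delta_k=\lim_{k\to\infty}E_k=0$.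 (ii) If $(\beta_kB_kR_k)\in\ell^1$, then $\Delta_k\le E_k=\mathcal O(1/B_k^2)$. In any case, $\Phi(x_k)-\Phi(x^* )+\langle A(x_k-x^* ),y^*\rangle=\mathcal O(\Delta_k)$ and $\Gamma(y_k)-\Gamma(y^* )-\langle Ax^*,y_k-y^*\rangle=\mathcal O(\Delta_k)$, and every weak subsequential limit point of $(x_k,y_k)$ is a primal-dual solution, i.e. belongs to $S$.
   Context: $\mathcal X,\mathcal Y$ are real Hilbert spaces and $A:\mathcal X\to\mathcal Y$ is a bounded linear operator with adjoint $A^*$. $\Phi=f+F$ and $\Gamma=g+G$, where $f:\mathcal X\to\mathbb R\cup\{+\infty\}$ and $g:\mathcal Y\to\mathbb R\cup\{+\infty\}$ are proper, convex and lower semicontinuous, and $F:\mathcal X\to\mathbb R$, $G:\mathcal Y\to\mathbb R$ are convex and smooth with parameters $L_F$ and $L_G$, respectively (differentiable with $L_F$-Lipschitz, respectively $L_G$-Lipschitz, gradients). $\partial$ is the convex subdifferential. The Lagrangian is $\mathcal L(x,y)=\Phi(x)+\langle Ax,y\rangle-\Gamma(y)$. $S$ is the set of primal-dual solutions (saddle points) of $\min_{x\in\mathcal X}\max_{y\in\mathcal Y}\mathcal L(x,y)$, i.e. the set of $(x^*,y^* )$ with $-A^*y^*\in\nabla F(x^* )+\partial f(x^* )$ and $Ax^*\in\nabla G(y^* )+\partial g(y^* )$. The vectors $\varepsilon_{k+1}$, $\epsilon_{k+1}$ represent approximation errors in the implementation of the algorithm. For the fixed $(x^*,y^* )\in S$,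 the primal-dual gap is $$\Delta_k:=\mathcal L(x_k,y^* )-\mathcal L(x^*,y_k)=[\Phi(x_k)-\Phi(x^* )+\langle A^*y^*,x_k-x^*\rangle]+[\Gamma(y_k)-\Gamma(y^* )-\langle Ax^*,y_k-y^*\rangle],$$ which is nonnegative, and the energy is $$E_k:=\Delta_k+\frac{\tau_k}2\|x_k-x^*\|^2+\frac{\sigma_k}2\|y_k-y^*\|^2,\qquad \tau_k:=\frac{\alpha_k}{\beta_k},\quad\sigma_k:=\frac{\delta_k}{\beta_k}.$$ Also $$R_k:=\frac{\sqrt{\beta_{k+1}}}{\beta_k}\max\left\{\frac{\|\varepsilon_{k+1}\|}{\sqrt{\alpha_{k+1}}},\frac{\|\epsilon_{k+1}\|}{\sqrt{\delta_{k+1}}}\right\}.$$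
   Formalization: Formal version: weak limit points lie in S only if (1/β_k)∉ℓ¹ and the error condition of (i) or (ii) holds; in (ii), E_{k+1}=O(1/B_k²) always, but E_k=O(1/B_k²) only if L_F>0, L_G>0 or inf β_k>0. As stated, both clauses fail. *)

(* Defs.v *)
From HB Require Import structures.
From mathcomp Require Import all_boot all_order all_algebra.
From mathcomp Require Import all_classical all_reals all_analysis.

Set Implicit Arguments.
Unset Strict Implicit.
Unset Printing Implicit Defensive.

Import Order.TTheory GRing.Theory Num.Theory.
Import numFieldNormedType.Exports.

Local Open Scope classical_set_scope.
Local Open Scope ring_scope.

HB.mixin Record CompleteNormedModule_isHilbert (R : realType) X
    of CompleteNormedModule R X := {
  inner : X -> X -> R ;
  innerC : forall u v, inner u v = inner v u ;
  innerDl : forall u v w, inner (u + v) w = inner u w + inner v w ;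
  innerZl : forall (a : R) u v, inner (a *: u) v = a * inner u v ;
  inner_normE : forall u, inner u u = `|u| ^+ 2
}.

#[short(type="hilbertType")]
HB.structure Definition Hilbert (R : realType) :=
  {X of CompleteNormedModule R X & CompleteNormedModule_isHilbert R X}.

Notation "''<' u , v >" := (inner u v)
  (at level 0, u at level 69, v at level 69, format "''<' u ,  v >") :
  ring_scope.

Section Operators.
Context {R : realType} {X Y : hilbertType R}.

Definition adjoint_of (A : X -> Y) (Astar : Y -> X) : Prop :=
  forall x y, '<A x, y> = '<x, Astar y>.

End Operators.

Section ConvexAnalysis.
Context {R : realType} {X : hilbertType R}.
Implicit Types (f : X -> \bar R) (F : X -> R).

Definition proper_fun f : Prop :=
  (forall x, f x != -oo%E) /\ (exists x, (f x < +oo)%E).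

Definition econvex_fun f : Prop :=
  forall (t : R) (x y : X), 0 <= t <= 1 ->
    (f (t *: x + (1 - t) *: y)%R <= t%:E * f x + (1 - t)%:E * f y)%E.

Definition proper_convex_lsc f : Prop :=
  [/\ proper_fun f, econvex_fun f & lower_semicontinuous f].

(* For proper f this is empty wherever f x = +oo. *)
Definition subdiff f (x : X) : set X :=
  [set u | forall z, (f x + ('<u, z - x>)%:E <= f z)%E].

Definition gradient_of F (gradF : X -> X) : Prop :=
  forall x, is_diff x F (fun h => '<gradF x, h>).

Definition convex_smooth (L : R) F (gradF : X -> X) : Prop :=
  [/\ convex_function [set: convex_lmodType X] F,
      gradient_of F gradF & L.-lipschitz gradF].

Definition weak_cvg (u : nat -> X) (l : X) : Prop :=
  forall v, '<v, u n> @[n --> \oo] --> '<v, l>.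

End ConvexAnalysis.

Definition weak_subseq_limit {R : realType} {X Y : hilbertType R}
    (x : nat -> X) (y : nat -> Y) : set (X * Y) :=
  [set p | exists phi : nat -> nat,
    [/\ {homo phi : m n / (m < n)%N},
        weak_cvg (x \o phi) p.1 & weak_cvg (y \o phi) p.2]].

Section Sequences.
Context {R : realType}.

Definition ell1 (a : nat -> R) : Prop := cvgn [normed series a].

(* u_k = O(v_k) as k tends to infinity, for extended-real sequences *)
Definition ebigO (u v : nat -> \bar R) : Prop :=
  exists C : R, \forall k \near \oo, (`|u k| <= C%:E * `|v k|)%E.

Definition Bcoef (beta : nat -> R) (j : nat) : R :=
  \prod_(i < j.+1) Num.sqrt (1 + 1 / beta i).

End Sequences.

Section PrimalDual.
Context {R : realType} {X Y : hilbertType R}.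

Definition composite {Z : hilbertType R} (f : Z -> \bar R) (F : Z -> R)
    (z : Z) : \bar R := (f z + (F z)%:E)%E.

Definition lagrangian (A : X -> Y) (Phi : X -> \bar R) (Gamma : Y -> \bar R)
    (x : X) (y : Y) : \bar R :=
  (Phi x + '<A x, y>%:E - Gamma y)%E.

Definition primal_dual_solutions (A : X -> Y) (Astar : Y -> X)
    (f : X -> \bar R) (gradF : X -> X) (g : Y -> \bar R) (gradG : Y -> Y) :
    set (X * Y) :=
  [set p |
    (exists2 u, subdiff f p.1 u & - Astar p.2 = gradF p.1 + u) /\
    (exists2 v, subdiff g p.2 v & A p.1 = gradG p.2 + v)].

(* Only x_k, y_k with k >= 1 are known to lie in the domains of f and g, so the
   gap and the energy may be +oo at k = 0. *)
Definition gap (A : X -> Y) (Phi : X -> \bar R) (Gamma : Y -> \bar R)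
    (xs : X) (ys : Y) (x : nat -> X) (y : nat -> Y) (k : nat) : \bar R :=
  (lagrangian A Phi Gamma (x k) ys - lagrangian A Phi Gamma xs (y k))%E.

Definition energy (A : X -> Y) (Phi : X -> \bar R) (Gamma : Y -> \bar R)
    (alpha beta delta : nat -> R)
    (xs : X) (ys : Y) (x : nat -> X) (y : nat -> Y) (k : nat) : \bar R :=
  (gap A Phi Gamma xs ys x y k
   + ((alpha k / beta k) / 2 * `|x k - xs| ^+ 2
      + (delta k / beta k) / 2 * `|y k - ys| ^+ 2)%:E)%E.

Definition error_ratio (alpha beta delta : nat -> R)
    (eps : nat -> X) (eta : nat -> Y) (k : nat) : R :=
  Num.sqrt (beta k.+1) / beta k *
  Num.max (`|eps k.+1| / Num.sqrt (alpha k.+1))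
          (`|eta k.+1| / Num.sqrt (delta k.+1)).

End PrimalDual.

(* Main.v *)
(* Test the subgradient inequalities at a reference point (a, b) and, with weight
   beta_k, at the previous iterate: the bilinear terms cancel and, with the
   descent lemma, the energy E_k(a, b) relative to (a, b) satisfies
     (1 + 1/beta_k) E_{k+1} <= E_k + R_k d_{k+1} + (R_k beta_k)^2 / (2 theta (1 + beta_k)),
   where d_{k+1} is a weighted distance from the iterate to (a, b).  At a saddle
   point d_{k+1} <= 2 sqrt E_{k+1}; multiplying by B_(k-1)^2 and completing the
   square gives the bound on sqrt E_{k+1}, and a Kronecker-type argument gives
   convergence.
   E_k -> 0 at a single saddle point does not by itself make weak limits saddle
   points.  But d_{k+1} is bounded for every (a, b), so the same recursion yields
   limsup E_k(a, b) <= 0 for all (a, b) in dom f x dom g, and weak lower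
   semicontinuity passes this saddle inequality to the limit. *)
Require Import Defs.
From HB Require Import structures.
From mathcomp Require Import all_boot all_order all_algebra.
From mathcomp Require Import all_classical all_reals all_analysis.
From mathcomp Require Import ring lra.

Set Implicit Arguments.
Unset Strict Implicit.
Unset Printing Implicit Defensive.

Import Order.TTheory GRing.Theory Num.Theory.
Import numFieldNormedType.Exports.

Local Open Scope classical_set_scope.
Local Open Scope ring_scope.

(** * Hilbert spaces and smooth convex functions *)

Section InnerProduct.
Context {R : realType} {X : hilbertType R}.
Implicit Types (u v w : X) (a : R).

Lemma innerDr u v w : '<u, v + w> = '<u, v> + '<u, w>.
Proof. by rewrite innerC innerDl ![inner _ u]innerC. Qed.

Lemma innerZr a u v : '<u, a *: v> = a * '<u, v>.
Proof. by rewrite innerC innerZl innerC. Qed.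

Lemma innerNl u v : '<- u, v> = - '<u, v>.
Proof. by rewrite -scaleN1r innerZl mulN1r. Qed.

Lemma innerNr u v : '<u, - v> = - '<u, v>.
Proof. by rewrite innerC innerNl innerC. Qed.

Definition innerE :=
  (@innerDl R X, innerDr, innerNl, innerNr, @innerZl R X, innerZr).

Lemma inner0r u : '<u, 0> = 0.
Proof. by rewrite -(scale0r 0) innerZr mul0r. Qed.

Lemma sqr_normE u : `|u| ^+ 2 = '<u, u>.
Proof. by rewrite inner_normE. Qed.

Lemma cauchy_schwarz u v : '<u, v> <= `|u| * `|v|.
Proof.
have [->|v0] := eqVneq v 0; first by rewrite inner0r normr0 mulr0.
have [->|u0] := eqVneq u 0; first by rewrite innerC inner0r normr0 mul0r.
have nu : 0 < `|u| by rewrite normr_gt0.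
have nv : 0 < `|v| by rewrite normr_gt0.
(* The square expands to [2 |u| |v| (|u| |v| - <u, v>)]; dividing by the positive norms gives the
   claim. *)
have : 0 <= `| (`|v| *: u - `|u| *: v) | ^+ 2 by exact: sqr_ge0.
rewrite sqr_normE !innerE [inner v u]innerC -!sqr_normE => h.
rewrite -(ler_pM2l (mulr_gt0 nu nv)).
nra.
Qed.

End InnerProduct.

Section ConvexSmooth.
Context {R : realType} {X : hilbertType R}.
Variables (L : R) (F : X -> R) (gF : X -> X).
Hypothesis L0 : 0 <= L.
Hypothesis csF : convex_smooth L F gF.

(** By convexity each difference quotient from [x] towards [z] with step in ]0, 1] is at most
    [F z - F x]; the limit from the right is the directional derivative. *)
Lemma convex_smooth_ge x z : F x + '<gF x, z - x> <= F z.
Proof.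
have [cF gradF _] := csF.
have [dF dFE] := gradF x.
pose v := z - x.
have cvgq := @diff_derivable _ _ _ F x v dF.
have limq : lim (h^-1 *: ((F \o shift x) (h *: v) - F x) @[h --> 0^']) =
  '<gF x, v> by rewrite -[LHS]/('D_v F x) (deriveE _ dF) dFE.
have {}cvgq : h^-1 *: ((F \o shift x) (h *: v) - F x) @[h --> 0^'] --> '<gF x, v>.
  by rewrite -limq; exact: cvgq.
have {}cvgq := cvg_dnbhs_at_right cvgq.
rewrite addrC -lerBrDr -(cvg_lim (@Rhausdorff R) cvgq).
apply: limr_le; first by apply/cvg_ex; exists '<gF x, v>.
near=> h.
have h0 : 0 < h by near: h; exact: nbhs_right_gt.
have h1 : h <= 1 by near: h; exact: nbhs_right_le.
have := cF (Itv01 (ltW h0) h1) z x; rewrite !inE => /(_ I I).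
rewrite /conv/= => Fh.
rewrite /= /GRing.scale/= ler_pdivrMl//.
have -> : h *: v + x = h *: z + (1 - h) *: x.
  by rewrite /v scalerBr scalerBl scale1r addrAC addrA.
have : F (h *: z + (1 - h) *: x) <= h * F z + (1 - h) * F x by exact: Fh.
lra.
Unshelve. all: by end_near.
Qed.

Lemma lipschitz_gradient x z : `|gF x - gF z| <= L * `|x - z|.
Proof. by have [_ _ lF] := csF; have := lF (x, z); apply. Qed.

(* Telescoping the gradient inequality over [n] equal steps [v]. *)
Lemma convex_smooth_le_steps x v n :
  F (x + n%:R *: v) <=
  F x + n%:R * '<gF x, v> + L * (n%:R * (n%:R + 1) / 2) * `|v| ^+ 2.
Proof.
elim: n => [|n IHn]; first by rewrite scale0r addr0; lra.
set xn := x + n%:R *: v in IHn; set xn1 := x + n.+1%:R *: v.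
have := convex_smooth_ge xn1 xn.
have -> : xn - xn1 = - v.
  by rewrite /xn /xn1 -natr1 scalerDl scale1r !addrA opprD addrA subrr add0r.
have : '<gF xn1 - gF x, v> <= L * n.+1%:R * `|v| ^+ 2.
  apply: (le_trans (cauchy_schwarz _ _)).
  rewrite expr2 mulrA ler_wpM2r//.
  apply: le_trans (lipschitz_gradient _ _) _.
  by rewrite /xn1 addrAC subrr add0r normrZ normr_nat mulrA.
rewrite !innerE -natr1; lra.
Qed.

(** The descent lemma by discrete telescoping: with [n] steps of size [(z - x) / n] the quadratic
    term becomes [s + s / n], and [n > s / e] makes the surplus smaller than [e]. *)
Lemma convex_smooth_le x z :
  F z <= F x + '<gF x, z - x> + L / 2 * `|z - x| ^+ 2.
Proof.
apply/ler_addgt0Pr => e e0.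
set s := L / 2 * `|z - x| ^+ 2.
have s0 : 0 <= s by rewrite mulr_ge0 ?sqr_ge0 ?divr_ge0.
pose n := (Num.trunc (s / e)).+1.
have n0 : 0 < n%:R :> R by rewrite ltr0n.
have : s / e < n%:R by rewrite truncnS_gt.
rewrite ltr_pdivrMr// => sn.
have := convex_smooth_le_steps x (n%:R^-1 *: (z - x)) n.
rewrite scalerA divff ?gt_eqF// scale1r addrC subrK innerZr mulrA divff ?gt_eqF//.
rewrite mul1r normrZ ger0_norm ?invr_ge0 ?ler0n//.
move=> /le_trans; apply.
have -> : L * (n%:R * (n%:R + 1) / 2) * (n%:R^-1 * `|z - x|) ^+ 2 = s + s / n%:R.
  rewrite /s; field; lra.
rewrite -[leRHS]addrA lerD2l lerD2l ler_pdivrMr// ltW//; lra.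
Qed.

End ConvexSmooth.

(** * Weak lower semicontinuity and subdifferentials *)

(** Lets [t] tend to 0. Minimality along a segment, divided by the step [t], leaves an error linear
    in [t], which this removes. *)
Lemma ler_addMt {R : realFieldType} (a b c : R) :
  (forall t, 0 < t -> t <= 1 -> a <= b + t * c) -> a <= b.
Proof.
move=> h; apply/ler_addgt0Pr => e e0.
have c1 : 0 < `|c| + 1 by rewrite ltr_wpDl.
(* Adding 1 to [|c|] keeps the denominator positive when [c = 0]. *)
have t0 : 0 < Num.min 1 (e / (`|c| + 1)) by rewrite lt_min ltr01 divr_gt0.
apply: (le_trans (h _ t0 _)); first by rewrite ge_min lexx.
rewrite lerD2l (le_trans (ler_norm _))// normrM (gtr0_norm t0).
have : Num.min 1 (e / (`|c| + 1)) <= e / (`|c| + 1) by rewrite ge_min lexx orbT.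
rewrite ler_pdivlMr// => /(le_trans _); apply.
by rewrite ler_wpM2l ?(ltW t0)// lerDl.
Qed.

Lemma scaler_avgE {R : pzRingType} {V : lmodType R} (t : R) (z p : V) :
  t *: z + (1 - t) *: p = p + t *: (z - p).
Proof. by rewrite scalerBl scale1r scalerBr addrCA. Qed.

Section Projection.
Context {R : realType} {X : hilbertType R}.
Implicit Types (C : set X) (l p z : X).

(** A minimizing sequence is Cauchy, so its limit attains the distance to [C]; moving from [p]
    slightly towards [z] stays in [C] and cannot come closer to [l], which is the variational
    inequality. *)
Lemma closed_convex_projection C l :
  closed C -> C !=set0 ->
  (forall t z w, 0 <= t <= 1 -> C z -> C w -> C (t *: z + (1 - t) *: w)) ->
  exists2 p, C p & forall z, C z -> '<l - p, z - p> <= 0.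
Proof.
move=> clC [z0 Cz0] cC.
pose D := [set `|l - z| ^+ 2 | z in C].
have D0 : D !=set0 by exists (`|l - z0| ^+ 2), z0.
have Dlb : lbound D 0 by move=> _ [z _ <-]; exact: sqr_ge0.
have infD : has_inf D by split => //; exists 0.
pose d := inf D.
have dD z : C z -> d <= `|l - z| ^+ 2.
  by move=> Cz; apply: ge_inf; [exact: infD.2|exists z].
have /choice[u uP] (n : nat) : exists z, C z /\ `|l - z| ^+ 2 < d + n.+1%:R^-1.
  have [//|_ [z Cz <-] zlt] := @inf_adherent _ D n.+1%:R^-1 _ infD.
  by exists z.
have uC n : C (u n) by have [] := uP n.
have ud n : `|l - u n| ^+ 2 < d + n.+1%:R^-1 by have [] := uP n.
(* The midpoint of [u n] and [u m] lies in [C], so its squared distance to [l] is at least [d]; the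
   parallelogram identity turns this into a bound on [u n - u m]. *)
have u_dist n m : `|u n - u m| ^+ 2 <= 2 * n.+1%:R^-1 + 2 * m.+1%:R^-1.
  have hb : 0 <= (2^-1 : R) <= 1 by apply/andP; split; lra.
  have := dD _ (cC _ _ _ hb (uC n) (uC m)).
  have := ud n; have := ud m.
  have -> : l - (2^-1 *: u n + (1 - 2^-1) *: u m) =
      2^-1 *: (l - u n) + 2^-1 *: (l - u m).
    have -> : 1 - 2^-1 = 2^-1 :> R by lra.
    rewrite !scalerBr addrACA -scalerDl opprD.
    by rewrite (_ : 2^-1 + 2^-1 = 1 :> R) ?scale1r//; lra.
  have -> : u n - u m = (l - u m) - (l - u n).
    by rewrite opprB [RHS]addrC addrA subrK.
  move: (l - u n) (l - u m) => a b.
  rewrite !sqr_normE !innerE [inner b a]innerC.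
  move: (n.+1%:R^-1) (m.+1%:R^-1) => n1 m1; lra.
have u_cvg : cvgn u.
  apply: cauchy_cvg; apply: cauchy_exP => e e0.
  pose N := Num.trunc (4 / e ^+ 2).
  have NE : 4 * N.+1%:R^-1 < e ^+ 2.
    rewrite ltr_pdivrMr ?ltr0n// mulrC -ltr_pdivrMr ?exprn_gt0//.
    exact: truncnS_gt.
  exists (u N); exists N => // n /= Nn.
  rewrite -ball_normE /ball_/= -(ltr_pXn2r (n:=2)) ?nnegrE ?(ltW e0)//.
  apply: le_lt_trans NE; apply: le_trans (u_dist _ _) _.
  have : n.+1%:R^-1 <= N.+1%:R^-1 :> R by rewrite lef_pV2 ?posrE ?ltr0n// ler_nat.
  move: (n.+1%:R^-1) (N.+1%:R^-1) => n1 N1; lra.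
pose p := limn u.
have Cp : C p.
  by apply: (closed_cvg _ clC _ p u_cvg); apply: nearW.
have pd : `|l - p| ^+ 2 <= d.
  have lu : `|l - u n| ^+ 2 @[n --> \oo] --> `|l - p| ^+ 2.
    have h : `|l - u n| @[n --> \oo] --> `|l - p|.
      by apply: cvg_norm; apply: cvgB => //; exact: cvg_cst.
    rewrite expr2; under eq_fun do rewrite expr2.
    exact: cvgM.
  have lh : d + n.+1%:R^-1 @[n --> \oo] --> d.
    rewrite -[X in _ --> X]addr0; apply: cvgD; first exact: cvg_cst.
    exact: cvg_harmonic.
  apply: ler_cvg_to lu lh _; apply: nearW => n; exact: ltW.
exists p => // z Cz.
apply: (@ler_addMt _ _ _ (`|z - p| ^+ 2)) => t t0 t1.
have t01 : 0 <= t <= 1 by rewrite (ltW t0).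
have := le_trans pd (dD _ (cC _ _ _ t01 Cz Cp)).
have -> : l - (t *: z + (1 - t) *: p) = (l - p) - t *: (z - p).
  by rewrite scaler_avgE opprD addrA.
rewrite !sqr_normE; move: (l - p) (z - p) => a b.
rewrite !innerE [inner b a]innerC => h.
rewrite add0r -(ler_pM2l t0).
have : 0 <= t * t * '<b, b> by rewrite -sqr_normE mulr_ge0 ?sqr_ge0 ?mulr_ge0 ?ltW.
lra.
Qed.

(** The sublevel set [C] is closed, convex and misses [l]. The hyperplane through the projection [p]
    with normal [l - p] separates [l] from [C], and weak convergence puts [u n] eventually on the
    side of [l]. *)
Lemma weak_lsc (f : X -> \bar R) (u : nat -> X) l r :
  econvex_fun f -> lower_semicontinuous f -> weak_cvg u l ->
  (r%:E < f l)%E -> \forall n \near \oo, (r%:E < f (u n))%E.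
Proof.
move=> cf lf ul rl.
pose C := [set z | (f z <= r%:E)%E].
have clC : closed C.
  rewrite -[C]setCK; apply: open_closedC.
  rewrite (_ : ~` C = [set z | (r%:E < f z)%E]); last first.
    by apply/seteqP; split=> z /=; rewrite /C/= ltNge => /negP.
  by move/lower_semicontinuousP : lf; apply.
have [C0|/set0P/negP/negPn/eqP C0] := pselect (C !=set0); last first.
  apply: nearW => n; rewrite ltNge; apply/negP => h.
  by have : C (u n) by []; rewrite C0.
have cC t z w : 0 <= t <= 1 -> C z -> C w -> C (t *: z + (1 - t) *: w).
  move=> t01 Cz Cw; have /andP[t0 t1] := t01.
  apply: le_trans (cf _ _ _ t01) _.
  have -> : r%:E = (t%:E * r%:E + (1 - t)%:E * r%:E)%E.
    by rewrite -!EFinM -EFinD; congr EFin; ring.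
  by apply: leeD; apply: lee_wpmul2l => //; rewrite lee_fin// subr_ge0.
have [p Cp pP] := closed_convex_projection l clC C0 cC.
have lp : 0 < `|l - p| ^+ 2.
  rewrite exprn_gt0// normr_gt0 subr_eq0; apply/eqP => lp.
  by move: rl; rewrite lp ltNge => /negP; apply.
have plt : '<l - p, p> < '<l - p, l>.
  by rewrite -subr_gt0 -innerNr -innerDr -sqr_normE.
have gtn : \forall n \near \oo, '<l - p, p> < '<l - p, u n>.
  by apply: (cvgr_gt _ (ul (l - p))).
apply: (@filterS _ _ _ _ _ _ gtn) => n h; rewrite ltNge; apply/negP => Cn.
by have := pP _ Cn; rewrite innerDr innerNr; lra.
Qed.

End Projection.

Section Subdifferential.
Context {R : realType} {X : hilbertType R}.
Implicit Types (f : X -> \bar R) (u z : X).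

Lemma subdiff_fin_num f z u :
  proper_fun f -> subdiff f z u -> f z \is a fin_num.
Proof.
move=> [fNy [z0 fz0]] /(_ z0) h; rewrite fin_numE fNy/=.
apply/eqP => fz; move: h; rewrite fz addye// leye_eq => /eqP fz0y.
by move: fz0; rewrite fz0y ltxx.
Qed.

Lemma subdiff_fine f z u a :
  f z \is a fin_num -> f a \is a fin_num -> subdiff f z u ->
  fine (f z) + '<u, a - z> <= fine (f a).
Proof.
by move=> fz fa /(_ a); rewrite -{1}(fineK fz) -{1}(fineK fa) -EFinD lee_fin.
Qed.

Variables (L : R) (F : X -> R) (gF : X -> X).
Hypothesis L0 : 0 <= L.
Hypothesis csF : convex_smooth L F gF.

(** Fermat's rule for [f + F + <w, .>]: compare [z0] with [z0 + t (z - z0)]. Convexity of [f] and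
    the descent lemma for [F] leave an error of order [t ^ 2], hence of order [t] after division.
    Where [f] is infinite the subgradient inequality is trivial. *)
Lemma subdiff_of_minimizer f (w z0 : X) :
  proper_fun f -> econvex_fun f -> f z0 \is a fin_num ->
  (forall z, f z \is a fin_num ->
    fine (f z0) + F z0 + '<w, z0> <= fine (f z) + F z + '<w, z>) ->
  subdiff f z0 (- w - gF z0).
Proof.
move=> [fNy _] cf fz0 zmin z.
have [fz|] := boolP (f z \is a fin_num); last first.
  by rewrite fin_numE fNy/= negbK => /eqP ->; exact: leey.
rewrite -(fineK fz) -(fineK fz0) -EFinD lee_fin.
apply: (@ler_addMt _ _ _ (L / 2 * `|z - z0| ^+ 2)) => t t0 t1.
have t01 : 0 <= t <= 1 by rewrite (ltW t0).
have := cf _ z z0 t01; set zt := t *: z + (1 - t) *: z0.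
rewrite -(fineK fz) -(fineK fz0) -!EFinM -EFinD => fzt.
have fztf : f zt \is a fin_num.
  by rewrite fin_numE fNy/= lt_eqF// (le_lt_trans fzt)// ltry.
move: fzt; rewrite -(fineK fztf) lee_fin.
have := zmin _ fztf; have := convex_smooth_le L0 csF z0 zt.
have zte : zt = z0 + t *: (z - z0) by exact: scaler_avgE.
have -> : zt - z0 = t *: (z - z0) by rewrite zte addrC addKr.
have -> : '<w, zt> = '<w, z0> + t * '<w, z - z0> by rewrite zte !innerE.
rewrite normrZ (gtr0_norm t0) exprMn [inner (- w - gF z0) _]innerDl !innerNl innerZr.
move: '<w, z - z0> '<gF z0, z - z0> (`|z - z0| ^+ 2) => p q r h1 h2 h3.
rewrite -(ler_pM2l t0); lra.
Qed.

(* Testing the inclusion at [a] and, with weight [b], at [z0]. *)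
Lemma prox_grad_step f (z0 z1 u a : X) b :
  0 <= b -> f z0 \is a fin_num -> f z1 \is a fin_num -> f a \is a fin_num ->
  subdiff f z1 u ->
  (1 + b) * (fine (f z1) + F z1) - '<u + gF z0, (z1 - a) + b *: (z1 - z0)>
    - (1 + b) * L / 2 * `|z1 - z0| ^+ 2
  <= (fine (f a) + F a) + b * (fine (f z0) + F z0).
Proof.
move=> b0 fz0 fz1 fa fu.
have := subdiff_fine fz1 fa fu; have := subdiff_fine fz1 fz0 fu.
have := convex_smooth_le L0 csF z0 z1.
have := convex_smooth_ge csF z0 a.
rewrite !innerE; move: (`|z1 - z0| ^+ 2) => n h1 h2 h3 h4.
have := ler_wpM2l b0 h2; have := ler_wpM2l b0 h3; lra.
Qed.

End Subdifferential.

Definition real_composite {R : realType} {Z : Type} (h : Z -> \bar R)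
    (H : Z -> R) z : R :=
  fine (h z) + H z.

(* Relative to an arbitrary reference point [(a, b)], not only a saddle point. *)
Definition real_gap {R : realType} {X Y : hilbertType R} (A : X -> Y)
    (f : X -> \bar R) (F : X -> R) (g : Y -> \bar R) (G : Y -> R)
    (x : nat -> X) (y : nat -> Y) a b k : R :=
  real_composite f F (x k) + '<A (x k), b> - real_composite g G b
  - (real_composite f F a + '<A a, y k> - real_composite g G (y k)).

(** * Weak limits of sequences whose gaps have nonpositive upper limit *)

Section WeakLimit.
Context {R : realType} {X Y : hilbertType R}.
Variables (A : {linear X -> Y}) (Astar : Y -> X).
Variables (f : X -> \bar R) (F : X -> R) (gradF : X -> X) (LF : R).
Variables (g : Y -> \bar R) (G : Y -> R) (gradG : Y -> Y) (LG : R).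
Hypothesis adjA : adjoint_of A Astar.
Hypotheses (pcl_f : proper_convex_lsc f) (pcl_g : proper_convex_lsc g).
Hypotheses (LF0 : 0 <= LF) (csF : convex_smooth LF F gradF).
Hypotheses (LG0 : 0 <= LG) (csG : convex_smooth LG G gradG).
Variables (x : nat -> X) (y : nat -> Y) (xh : X) (yh : Y).
Hypothesis fin_xy : forall k, f (x k) \is a fin_num /\ g (y k) \is a fin_num.
Hypotheses (xw : weak_cvg x xh) (yw : weak_cvg y yh).
Hypothesis rgap_limsup : forall a b, f a \is a fin_num -> g b \is a fin_num ->
  forall e, 0 < e -> \forall k \near \oo, real_gap A f F g G x y a b k <= e.

(** The reals [r] and [s] replace [f xh] and [g yh], whose finiteness is not yet known. Weak lower
    semicontinuity handles [f] and [g]; [F] and [G] are minorized by their linearizations at the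
    limit, and each bilinear term has one fixed argument, so both are controlled by weak
    convergence. *)
Lemma weak_limit_saddle_ineq a b r s :
  f a \is a fin_num -> g b \is a fin_num -> (r%:E < f xh)%E -> (s%:E < g yh)%E ->
  r + F xh + '<A xh, b> - real_composite g G b
    - (real_composite f F a + '<A a, yh> - (s + G yh)) <= 0.
Proof.
move=> fa gb rf sg; apply/ler_addgt0Pr => e e0.
have [_ cf lf] := pcl_f; have [_ cg lg] := pcl_g.
(* Five errors are added: four inner products and the gap itself. *)
have e5 : 0 < e / 5 by rewrite divr_gt0.
have near_inner (Z : hilbertType R) (u : nat -> Z) l v : weak_cvg u l ->
    \forall k \near \oo, `|'<v, l> - '<v, u k>| <= e / 5.
  by move=> /(_ v) /cvgrPdist_le /(_ _ e5).
near \oo => k.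
have [fxk gyk] := fin_xy k.
have hr : (r%:E < f (x k))%E by near: k; exact: weak_lsc cf lf xw rf.
have hs : (s%:E < g (y k))%E by near: k; exact: weak_lsc cg lg yw sg.
have hF : `|'<gradF xh, xh> - '<gradF xh, x k>| <= e / 5.
  by near: k; exact: near_inner.
have hG : `|'<gradG yh, yh> - '<gradG yh, y k>| <= e / 5.
  by near: k; exact: near_inner.
have hb : `|'<Astar b, xh> - '<Astar b, x k>| <= e / 5.
  by near: k; exact: near_inner.
have ha : `|'<A a, yh> - '<A a, y k>| <= e / 5.
  by near: k; exact: near_inner.
have hgap : real_gap A f F g G x y a b k <= e / 5 by near: k; exact: rgap_limsup.
have := convex_smooth_ge csF xh (x k); have := convex_smooth_ge csG yh (y k).
move: hr hs hF hG hb ha hgap.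
rewrite -(fineK fxk) -(fineK gyk) !lte_fin !ler_norml.
rewrite /real_gap /real_composite ![inner (Astar b) _]innerC -!adjA !innerE.
move=> hr hs /andP[_ hF] /andP[_ hG] /andP[_ hb] /andP[ha _] hgap h1 h2.
lra.
Unshelve. all: by end_near.
Qed.

(** If a value were infinite, [r] or [s] could be any real; the choices below make the left side of
    the saddle inequality equal to 1, which contradicts its upper bound 0. *)
Lemma weak_limit_fin a b : f a \is a fin_num -> g b \is a fin_num ->
  f xh \is a fin_num /\ g yh \is a fin_num.
Proof.
move=> fa gb.
have [[fNy _] _ _] := pcl_f; have [[gNy _] _ _] := pcl_g.
have below (e : \bar R) : e != -oo%E -> exists r, (r%:E < e)%E.
  case: e => [r _|_|//]; last by exists 0; exact: ltry.
  by exists (r - 1); rewrite lte_fin; lra.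
have [r0 hr0] := below _ (fNy xh); have [s0 hs0] := below _ (gNy yh).
split; rewrite fin_numE ?fNy ?gNy/=; apply/eqP => infty.
- pose c := '<A xh, b> - real_composite g G b
    - (real_composite f F a + '<A a, yh> - (s0 + G yh)).
  have := @weak_limit_saddle_ineq a b (1 - F xh - c) s0 fa gb.
  by rewrite infty ltry /c => /(_ isT hs0); lra.
- pose c := r0 + F xh + '<A xh, b> - real_composite g G b
    - (real_composite f F a + '<A a, yh> - G yh).
  have := @weak_limit_saddle_ineq a b r0 (1 - c) fa gb hr0.
  by rewrite infty ltry /c => /(_ isT); lra.
Qed.

(** Letting [r] and [s] increase to the actual values gives the exact saddle inequality. With
    [w = yh], [xh] minimizes [Phi + <A ., yh>]; with [z = xh], [yh] minimizes [Gamma - <A xh, .>].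
    Fermat's rule turns these into the two inclusions. *)
Lemma weak_limit_solution a b : f a \is a fin_num -> g b \is a fin_num ->
  primal_dual_solutions A Astar f gradF g gradG (xh, yh).
Proof.
move=> fa gb; have [fx gy] := weak_limit_fin fa gb.
have [pf cf _] := pcl_f; have [pg cg _] := pcl_g.
have ineq z w : f z \is a fin_num -> g w \is a fin_num ->
    real_composite f F xh + '<A xh, w> - real_composite g G w
    - (real_composite f F z + '<A z, yh> - real_composite g G yh) <= 0.
  move=> fz gw; apply/ler_addgt0Pr => e e0.
  have hr : ((fine (f xh) - e / 2)%:E < f xh)%E.
    by rewrite -[ltRHS](fineK fx) lte_fin; lra.
  have hs : ((fine (g yh) - e / 2)%:E < g yh)%E.
    by rewrite -[ltRHS](fineK gy) lte_fin; lra.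
  have := weak_limit_saddle_ineq fz gw hr hs.
  by rewrite /real_composite; lra.
split=> /=.
- exists (- Astar yh - gradF xh); last by rewrite addrC subrK.
  apply: (subdiff_of_minimizer LF0 csF) => // z fz.
  have := ineq z yh fz gy.
  by rewrite ![inner (Astar yh) _]innerC -!adjA /real_composite; lra.
- exists (A xh - gradG yh); last by rewrite addrC subrK.
  rewrite -[A xh]opprK; apply: (subdiff_of_minimizer LG0 csG) => // z gz.
  have := ineq xh z fx gz.
  by rewrite !innerNl /real_composite; lra.
Qed.

End WeakLimit.

(** * Summable sequences and weights *)

Section Ell1.
Context {R : realType}.
Implicit Types (s w u : nat -> R).

Lemma normed_seriesE s n : [normed series s] n = \sum_(j < n) `|s j|.
Proof. by rewrite -[LHS]/(series (fun k => `|s k|) n) seriesEord. Qed.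

Lemma normed_series_nondecreasing s :
  {homo [normed series s] : n m / (n <= m)%N >-> n <= m}.
Proof.
apply/nondecreasing_seqP => n.
by rewrite !normed_seriesE big_ord_recr/= lerDl.
Qed.

Lemma bounded_ell1 s M : (forall k, \sum_(j < k) `|s j| <= M) -> ell1 s.
Proof.
move=> sM; apply: nondecreasing_is_cvgn.
  exact: normed_series_nondecreasing.
by exists M => _ [n _ <-]; rewrite normed_seriesE.
Qed.

Lemma ell1_tail s (e : R) : ell1 s -> 0 < e ->
  exists N, forall k, (N <= k)%N ->
    \sum_(j < k) `|s j| <= \sum_(j < N) `|s j| + e.
Proof.
move=> s1 e0.
have /cvgrPdist_le/(_ e e0) [N _ /(_ N (leqnn N)) /= hN] := s1.
exists N => k _.
have := nondecreasing_cvgn_le (normed_series_nondecreasing s) s1 k.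
have := nondecreasing_cvgn_le (normed_series_nondecreasing s) s1 N.
move: hN; rewrite -/([normed series s] N) !normed_seriesE ler_norml.
case/andP=> _.
lra.
Qed.

Lemma ell1_bounded s : ell1 s -> exists M, forall k, \sum_(j < k) `|s j| <= M.
Proof.
move=> s1; exists (limn [normed series s]) => k; rewrite -normed_seriesE.
exact: nondecreasing_cvgn_le (normed_series_nondecreasing s) s1 k.
Qed.

Lemma ell1_le s u : (forall k, `|s k| <= `|u k|) -> ell1 u -> ell1 s.
Proof.
move=> su /ell1_bounded[M uM]; apply: (@bounded_ell1 _ M) => k.
by apply: le_trans (uM k); apply: ler_sum.
Qed.

Lemma ell1Z s c : ell1 s -> ell1 (fun k => c * s k).
Proof.
move=> /ell1_bounded[M sM]; apply: (@bounded_ell1 _ (`|c| * M)) => k.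
under eq_bigr do rewrite normrM.
by rewrite -mulr_sumr ler_wpM2l.
Qed.

Lemma ell1_term_bounded s : ell1 s -> exists M, forall k, `|s k| <= M.
Proof.
move=> /ell1_bounded[M sM]; exists M => k; apply: le_trans (sM k.+1).
by rewrite big_ord_recr/= lerDr sumr_ge0.
Qed.

(** The sum starts at 0 rather than at [m], which only enlarges the bound since [s] is nonnegative.
    A free [m] lets a recursion start at an index where the energy is known to be finite. *)
Lemma ler_add_telescope a s (m k : nat) :
  (forall j, 0 <= s j) ->
  (forall j, (m <= j)%N -> a j.+1 <= a j + s j) ->
  (m <= k)%N -> a k <= a m + \sum_(j < k) s j.
Proof.
move=> s0 as_ /subnK <-; elim: (k - m)%N => [|n IHn].
  by rewrite add0n lerDl sumr_ge0.
rewrite addSn big_ord_recr/= addrA.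
by apply: le_trans (as_ _ _) _; rewrite ?leq_addl// lerD2r.
Qed.

(* A Kronecker-type lemma: split the sum at an index beyond which the tail of
   [s] is small, and use that the weights at earlier indices are negligible. *)
Lemma weighted_sum_le w s u K m :
  (forall k, 0 < w k) -> {homo w : i j / (i <= j)%N >-> i <= j} ->
  (forall M, exists N, forall k, (N <= k)%N -> M <= w k) ->
  ell1 s ->
  (forall k, (m <= k)%N -> u k * w k <= K + \sum_(j < k) w j.+1 * `|s j|) ->
  forall e, 0 < e -> exists N, forall k, (N <= k)%N -> u k <= e.
Proof.
move=> w0 wnd woo s1 uw e e0.
have e20 : 0 < e / 2 by rewrite divr_gt0.
have [N0 hN0] := ell1_tail s1 e20.
have [N1 hN1] := woo ((K + \sum_(j < N0) w j.+1 * `|s j|) / (e / 2)).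
exists (maxn m (maxn N0 N1)) => k; rewrite !geq_max => /and3P[mk N0k N1k].
rewrite -(ler_pM2r (w0 k)); apply: le_trans (uw _ mk) _.
have := hN1 _ N1k; rewrite ler_pdivrMr// => hw.
have := hN0 _ N0k.
rewrite -!(big_mkord xpredT (fun j => `|s j|)).
rewrite -!(big_mkord xpredT (fun j => w j.+1 * `|s j|)) in hw *.
rewrite (big_cat_nat _ N0k)//= (big_cat_nat (F := fun j => w j.+1 * _) _ N0k)//=.
rewrite lerD2l => tail.
have : \sum_(N0 <= j < k) w j.+1 * `|s j| <= w k * (e / 2).
  apply: (@le_trans _ _ (w k * \sum_(N0 <= j < k) `|s j|)); last first.
    by rewrite ler_wpM2l// ltW.
  rewrite mulr_sumr big_nat_cond [leRHS]big_nat_cond; apply: ler_sum => j.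
  rewrite andbT => /andP[_ jk]; exact: ler_wpM2r (wnd _ _ jk).
lra.
Qed.

(** Index 0 is left out because the gap and the energy may be infinite there. *)
Lemma cvge0_of_small (u : nat -> \bar R) (v : nat -> R) :
  (forall k, (1 <= k)%N -> u k = (v k)%:E) ->
  (forall k, (1 <= k)%N -> 0 <= v k) ->
  (forall e, 0 < e -> exists N, forall k, (N <= k)%N -> v k <= e) ->
  u k @[k --> \oo] --> 0%E.
Proof.
move=> uv v0 vs; apply/fine_cvgP; split.
  by exists 1%N => // k /= k1; rewrite uv.
apply/cvgrPdist_le => e e0; have [N hN] := vs e e0.
exists N.+1 => // k /= Nk; have k1 : (1 <= k)%N by exact: leq_trans Nk.
by rewrite uv//= sub0r normrN ger0_norm ?v0// hN// ltnW.
Qed.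

End Ell1.

(** * Product weights and the scalar energy recursion *)

Section Weights.
Context {R : realType}.
Variable beta : nat -> R.
Hypothesis beta0 : forall k, 0 < beta k.

(* [weight k] is the paper's [B_(k-1)], with [weight 0 = 1]. *)
Definition weight k : R := \prod_(i < k) Num.sqrt (1 + 1 / beta i).

Lemma factor_gt1 k : 1 < 1 + 1 / beta k.
Proof. by rewrite ltrDl divr_gt0. Qed.

Lemma weightS k : weight k.+1 = weight k * Num.sqrt (1 + 1 / beta k).
Proof. by rewrite /weight big_ord_recr. Qed.

Lemma weight_gt0 k : 0 < weight k.
Proof.
rewrite /weight prodr_gt0// => i _.
by rewrite sqrtr_gt0 (lt_trans ltr01)// factor_gt1.
Qed.

Lemma sqr_weightS k : weight k.+1 ^+ 2 = weight k ^+ 2 * (1 + 1 / beta k).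
Proof.
by rewrite weightS exprMn sqr_sqrtr// (le_trans ler01)// ltW// factor_gt1.
Qed.

Lemma weight_nondecreasing : {homo weight : i j / (i <= j)%N >-> i <= j}.
Proof.
apply/nondecreasing_seqP => k.
rewrite -(ler_pXn2r (n:=2)) ?nnegrE ?(ltW (weight_gt0 _))//.
by rewrite sqr_weightS ler_peMr ?sqr_ge0// ltW// factor_gt1.
Qed.

Lemma weight_ge1 k : 1 <= weight k.
Proof.
by have := weight_nondecreasing (leq0n k); rewrite {1}/weight big_ord0.
Qed.

(** Expanding the product of the [1 + 1 / beta j] and keeping the terms of order at most one. Hence
    the weights diverge when [1 / beta] is not summable. *)
Lemma sqr_weight_ge k : 1 + \sum_(j < k) (beta j)^-1 <= weight k ^+ 2.
Proof.
elim: k => [|k IHk]; first by rewrite /weight !big_ord0; lra.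
rewrite sqr_weightS big_ord_recr/= div1r.
have : 1 <= weight k ^+ 2 by rewrite exprn_ege1// weight_ge1.
have : 0 < (beta k)^-1 by rewrite invr_gt0.
move: (beta k)^-1 => b; nra.
Qed.

Lemma sqr_weight_unbounded : ~ ell1 (fun k => 1 / beta k) ->
  forall M, exists N, forall k, (N <= k)%N -> M <= weight k ^+ 2.
Proof.
move=> nb M; apply: contrapT => hM; apply: nb.
apply: (@bounded_ell1 _ _ M) => k; rewrite leNgt; apply/negP => Mk.
apply: hM; exists k => j kj.
apply: (@le_trans _ _ (weight k ^+ 2)); last first.
  by rewrite lerXn2r ?nnegrE ?(ltW (weight_gt0 _))// weight_nondecreasing.
apply: le_trans (sqr_weight_ge k); rewrite (le_trans (ltW Mk))//.
rewrite -[leLHS]add0r lerD//; apply: ler_sum => i _.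
by rewrite div1r gtr0_norm// invr_gt0.
Qed.

Lemma weight_unbounded : ~ ell1 (fun k => 1 / beta k) ->
  forall M, exists N, forall k, (N <= k)%N -> M <= weight k.
Proof.
move=> nb M; have [N hN] := sqr_weight_unbounded nb (M ^+ 2).
exists N => k /hN; have [M0|M0] := leP 0 M.
  by rewrite ler_pXn2r ?nnegrE// ltW// weight_gt0.
by move=> _; rewrite ltW// (lt_trans M0)// weight_gt0.
Qed.

Section Recursion.
Variables (theta : R) (theta0 : 0 < theta).

(** Multiplication by [weight k ^ 2] absorbs the factor [1 + 1 / beta k]. Both error terms are
    enlarged to carry the weight [weight k.+1 ^ 2]. The bound [q] stays abstract: it is [2 sqrt E1]
    at a saddle point and the scaled distance elsewhere. *)
Lemma weighted_energy_step k (E E1 q r : R) : 0 <= q -> 0 <= r ->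
  (1 + 1 / beta k) * E1
    <= E + q * r + r ^+ 2 * beta k ^+ 2 / (2 * theta * (1 + beta k)) ->
  weight k.+1 ^+ 2 * E1 <= weight k ^+ 2 * E
    + weight k.+1 ^+ 2 * (q * (beta k * r) + (beta k * r) ^+ 2 / (2 * theta)).
Proof.
move=> q0 r0 h; have b0 := beta0 k; rewrite sqr_weightS.
rewrite -[leLHS]mulrA -[X in _ <= _ + X]mulrA -mulrDr.
rewrite ler_wpM2l ?sqr_ge0//; apply: (le_trans h).
rewrite -[leLHS]addrA lerD2l [leRHS]mulrDr lerD//.
  have -> : (1 + 1 / beta k) * (q * (beta k * r)) = q * r + beta k * (q * r).
    by field; lra.
  by rewrite lerDl !mulr_ge0// ltW.
have -> : (1 + 1 / beta k) * ((beta k * r) ^+ 2 / (2 * theta)) =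
    r ^+ 2 * beta k ^+ 2 / (2 * theta * (1 + beta k))
      * ((1 + beta k) ^+ 2 / beta k).
  by field; rewrite !gt_eqF ?addr_gt0.
rewrite ler_peMr//; last by rewrite ler_pdivlMr//; nra.
by rewrite divr_ge0 ?mulr_ge0 ?sqr_ge0 ?addr_ge0// ltW.
Qed.

(** Write [a], [b] for the weighted square roots of [E], [E1], with [rho = beta k * weight k.+1 * r]
    and [s ^ 2 = 1 + 1 / (2 theta)]. The weighted step reads [b ^ 2 <= a ^ 2 + 2 b rho + (s ^ 2 - 1)
    rho ^ 2], that is [(b - rho) ^ 2 <= a ^ 2 + (s rho) ^ 2 <= (a + s rho) ^ 2], so
    [b <= a + (1 + s) rho]. *)
Lemma sqrt_energy_step k (E E1 r : R) : 0 <= E -> 0 <= E1 -> 0 <= r ->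
  (1 + 1 / beta k) * E1 <= E + (2 * Num.sqrt E1) * r
    + r ^+ 2 * beta k ^+ 2 / (2 * theta * (1 + beta k)) ->
  weight k.+1 * Num.sqrt E1 <= weight k * Num.sqrt E
    + (1 + Num.sqrt (1 + 1 / (2 * theta))) * (beta k * weight k.+1 * r).
Proof.
move=> E0 E10 r0 h; have b0 := beta0 k.
have h2 := weighted_energy_step (mulr_ge0 (ler0n R 2) (sqrtr_ge0 E1)) r0 h.
have w0 := weight_gt0 k; have w10 := weight_gt0 k.+1.
set s := Num.sqrt (1 + _).
have s2 : s ^+ 2 = 1 + 1 / (2 * theta).
  by rewrite sqr_sqrtr// addr_ge0// divr_ge0// mulr_ge0// ltW.
have := sqr_sqrtr E0; have := sqr_sqrtr E10; move: h2 (sqrtr_ge0 E).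
set e := Num.sqrt E; set e1 := Num.sqrt E1; clearbody e e1.
move=> + e_ge0 => /[swap] <- /[swap] <-; rewrite -!exprMn.
set rho := beta k * weight k.+1 * r.
have rho0 : 0 <= rho by rewrite !mulr_ge0// ltW.
have -> : weight k.+1 ^+ 2 * (2 * e1 * (beta k * r) + (beta k * r) ^+ 2 / (2 * theta))
    = 2 * (weight k.+1 * e1) * rho + rho ^+ 2 * (s ^+ 2 - 1).
  by rewrite s2 /rho; field; rewrite gt_eqF.
have : 0 <= weight k * e by rewrite mulr_ge0 ?e_ge0// ltW.
have : 0 <= s by exact: sqrtr_ge0.
move: (weight k * e) (weight k.+1 * e1) => a b s0 a0 hab.
have sr : 0 <= s * rho by rewrite mulr_ge0.
clearbody rho s.
rewrite leNgt; apply/negP => hlt.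
have : a + s * rho < b - rho by lra.
have : (b - rho) ^+ 2 <= a ^+ 2 + (s * rho) ^+ 2 by rewrite exprMn; lra.
move: (s * rho) (b - rho) sr => p q p0 h1 h3; nra.
Qed.

End Recursion.
End Weights.

(** * The primal-dual algorithm *)

Lemma ler_amgm {R : realFieldType} (c r m : R) : 0 < c ->
  r * m <= c * m ^+ 2 + r ^+ 2 / (4 * c).
Proof.
move=> c0; rewrite -subr_ge0.
have -> : c * m ^+ 2 + r ^+ 2 / (4 * c) - r * m = (2 * c * m - r) ^+ 2 / (4 * c).
  by field; rewrite gt_eqF.
by rewrite divr_ge0 ?sqr_ge0// mulr_ge0// ltW.
Qed.

(** Here [u] is the distance vector to the reference point and [d] the last step. After
    Cauchy-Schwarz, Young's inequality with constant [theta (1 + b)] and [(1 + b) s ^ 2 <= a] bound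
    the part in [d] by a [theta]-fraction of the quadratic step term, plus a term in [r ^ 2]. *)
Lemma inner_error_le {R : realType} {Z : hilbertType R} (theta b r a s : R)
    (e u d : Z) :
  0 < theta -> 0 < b -> 0 <= r -> 0 <= a -> 0 <= s ->
  (1 + b) * s ^+ 2 <= a -> `|e| <= r * b * s ->
  '<e, u + b *: d> <= b * (r * (s * `|u|))
    + theta * (2 * b + 1) / 2 * (a * `|d| ^+ 2)
    + b * (r ^+ 2 * b ^+ 2 / (4 * (theta * (1 + b)))).
Proof.
move=> th0 b0 r0 a0 s0 sa er.
apply: le_trans (cauchy_schwarz _ _) _.
have : `|u + b *: d| <= `|u| + b * `|d|.
  by rewrite (le_trans (ler_normD _ _))// normrZ gtr0_norm.
move=> /(ler_pM (normr_ge0 _) (normr_ge0 _) er) /le_trans; apply.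
have c0 : 0 < theta * (1 + b) by rewrite mulr_gt0// addr_gt0.
have := ler_amgm (r * b) (s * `|d|) c0; rewrite -exprMn.
move: (_ / _) => am /(ler_wpM2l (ltW b0)).
have := ler_wpM2r (sqr_ge0 `|d|) sa => /(ler_wpM2l (ltW (mulr_gt0 b0 th0))).
have : 0 <= theta * (a * `|d| ^+ 2).
  by rewrite !mulr_ge0 ?sqr_ge0// ltW.
rewrite exprMn; move: (`|d| ^+ 2) => n h1 h2 h3.
have -> : r * b * s * (`|u| + b * `|d|) =
  b * (r * (s * `|u|)) + b * (r * b * (s * `|d|)) by ring.
rewrite -addrA lerD2l (le_trans h3)// mulrDr lerD2r.
have -> : b * (theta * (1 + b) * (s ^+ 2 * n)) =
  b * theta * ((1 + b) * s ^+ 2 * n) by ring.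
apply: le_trans h2 _; lra.
Qed.

Section Algorithm.
Context {R : realType} {X Y : hilbertType R}.
Variables (A : {linear X -> Y}) (Astar : Y -> X).
Variables (f : X -> \bar R) (F : X -> R) (gradF : X -> X) (LF : R).
Variables (g : Y -> \bar R) (G : Y -> R) (gradG : Y -> Y) (LG : R).
Variables (alpha beta delta : nat -> R) (theta : R).
Variables (eps : nat -> X) (eta : nat -> Y) (x : nat -> X) (y : nat -> Y).
Hypothesis adjA : adjoint_of A Astar.
Hypotheses (pcl_f : proper_convex_lsc f) (pcl_g : proper_convex_lsc g).
Hypotheses (LF0 : 0 <= LF) (csF : convex_smooth LF F gradF).
Hypotheses (LG0 : 0 <= LG) (csG : convex_smooth LG G gradG).
Hypothesis stepx : forall k, exists2 u, subdiff f (x k.+1) u &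
  alpha k *: (x k.+1 - x k) + beta k *: Astar (y k.+1 - y k)
  + u + gradF (x k) + Astar (y k.+1) = eps k.+1.
Hypothesis stepy : forall k, exists2 v, subdiff g (y k.+1) v &
  - (beta k *: A (x k.+1 - x k)) + delta k *: (y k.+1 - y k)
  - A (x k.+1) + v + gradG (y k) = eta k.+1.
Hypotheses (alpha0 : forall k, 0 < alpha k) (beta0 : forall k, 0 < beta k).
Hypotheses (delta0 : forall k, 0 < delta k) (theta01 : 0 < theta < 1).
Hypothesis alphaL : forall k,
  (1 - theta) * alpha k >= (beta k + 1) * LF / (2 * beta k + 1).
Hypothesis deltaL : forall k,
  (1 - theta) * delta k >= (beta k + 1) * LG / (2 * beta k + 1).
Hypothesis alphaS : forall k, beta k.+1 / alpha k.+1 >= (1 + beta k) / alpha k.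
Hypothesis deltaS : forall k, beta k.+1 / delta k.+1 >= (1 + beta k) / delta k.

Local Notation Phi := (real_composite f F).
Local Notation Gamma := (real_composite g G).
Local Notation fin k := (f (x k) \is a fin_num /\ g (y k) \is a fin_num).
Local Notation err := (error_ratio alpha beta delta eps eta).

Local Notation rgap := (real_gap A f F g G x y).

Definition renergy a b k : R :=
  rgap a b k + ((alpha k / beta k) / 2 * `|x k - a| ^+ 2
                + (delta k / beta k) / 2 * `|y k - b| ^+ 2).

Lemma iterate_fin k : (1 <= k)%N -> fin k.
Proof.
case: k => // k _; have [pf _ _] := pcl_f; have [pg _ _] := pcl_g; split.
- by have [u + _] := stepx k; exact: subdiff_fin_num.
- by have [u + _] := stepy k; exact: subdiff_fin_num.
Qed.

Lemma fin_from m k : fin m -> (m <= k)%N -> fin k.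
Proof.
by case: k => [|k]; [rewrite leqn0 => /[swap] /eqP ->|move=> *; exact: iterate_fin].
Qed.

(** The two inclusions are tested at [a] and [b] and, with weight [beta k], at the previous iterate.
    Polarization produces [alpha k (2 beta k + 1) / 2] times the squared step; the step-size
    condition spends a fraction [1 - theta] of it on the descent-lemma error and leaves [theta] for
    the errors [eps] and [eta]. *)
Lemma gap_step k a b : fin k -> f a \is a fin_num -> g b \is a fin_num ->
  (1 + beta k) * rgap a b k.+1
  + alpha k / 2 * `|x k.+1 - a| ^+ 2 + delta k / 2 * `|y k.+1 - b| ^+ 2
  + theta * (2 * beta k + 1) / 2 *
      (alpha k * `|x k.+1 - x k| ^+ 2 + delta k * `|y k.+1 - y k| ^+ 2)
  <= beta k * rgap a b k
  + alpha k / 2 * `|x k - a| ^+ 2 + delta k / 2 * `|y k - b| ^+ 2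
  + '<eps k.+1, (x k.+1 - a) + beta k *: (x k.+1 - x k)>
  + '<eta k.+1, (y k.+1 - b) + beta k *: (y k.+1 - y k)>.
Proof.
move=> [fx gy] fa gb; have [fx1 gy1] := iterate_fin (isT : (1 <= k.+1)%N).
have b0 := beta0 k.
have [u fu uE] := stepx k; have [v gv vE] := stepy k.
have := prox_grad_step LF0 csF (ltW b0) fx fx1 fa fu.
have := prox_grad_step LG0 csG (ltW b0) gy gy1 gb gv.
rewrite /real_gap -!/(real_composite _ _ _).
have c0 : 0 < 2 * beta k + 1 by lra.
have := alphaL k; rewrite ler_pdivrMr//.
move=> /(ler_wpM2r (sqr_ge0 `|x k.+1 - x k|)).
have := deltaL k; rewrite ler_pdivrMr//.
move=> /(ler_wpM2r (sqr_ge0 `|y k.+1 - y k|)).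
rewrite -uE -vE !sqr_normE.
have innA w z : '<Astar w, z> = '<A z, w> by rewrite innerC -adjA.
move: (Phi _) (Phi _) (Phi _) (Gamma _) (Gamma _) (Gamma _).
move: (x k) (x k.+1) (y k) (y k.+1) => x0 x1 y0 y1.
rewrite (raddfB A) !(innerE, innA) [inner x0 x1]innerC [inner y0 y1]innerC.
rewrite [inner a x1]innerC [inner a x0]innerC [inner b y1]innerC [inner b y0]innerC.
move=> P0 P1 P2 G0 G1 G2 h1 h2 h3 h4.
have h2' : 0 <= (2 : R)^-1 by [].
(* Adding the two tested inclusions and half of the two step-size conditions gives the claim
   exactly: what remains is an identity, including the cancellation of the bilinear terms. *)
have := lerD (lerD h3 h4) (ler_wpM2l h2' (lerD h1 h2)).
rewrite -subr_ge0 => h; rewrite -subr_ge0; apply: le_trans h _.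
rewrite le_eqVlt; apply/orP; left; apply/eqP.
by field.
Qed.

Lemma sqr_step_ratio (a a1 b1 c : R) : 0 < a -> 0 < a1 -> 0 < b1 ->
  c / a <= b1 / a1 -> c * Num.sqrt (a1 / b1) ^+ 2 <= a.
Proof.
move=> a0 a10 b10 h; rewrite sqr_sqrtr ?divr_ge0 ?(ltW a10) ?(ltW b10)//.
rewrite mulrA ler_pdivrMr//; move: h.
by rewrite ler_pdivrMr// mulrAC ler_pdivlMr// [b1 * a]mulrC.
Qed.

Lemma error_ratio_ge0 k : 0 <= err k.
Proof.
by rewrite /error_ratio mulr_ge0 ?divr_ge0 ?sqrtr_ge0 ?(ltW (beta0 _)).
Qed.

Lemma norm_error_le (a1 b b1 n m : R) : 0 < a1 -> 0 < b -> 0 < b1 ->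
  n / Num.sqrt a1 <= m ->
  n <= Num.sqrt b1 / b * m * b * Num.sqrt (a1 / b1).
Proof.
move=> a10 b0 b10; rewrite sqrtrM ?(ltW a10)// sqrtrV ?(ltW b10)//.
have sa : 0 < Num.sqrt a1 by rewrite sqrtr_gt0.
have sb : 0 < Num.sqrt b1 by rewrite sqrtr_gt0.
rewrite ler_pdivrMr// => /le_trans; apply; rewrite le_eqVlt; apply/orP; left.
by apply/eqP; field; rewrite !gt_eqF.
Qed.

Lemma norm_eps_le k :
  `|eps k.+1| <= err k * beta k * Num.sqrt (alpha k.+1 / beta k.+1).
Proof. by apply: norm_error_le => //; rewrite le_max lexx. Qed.

Lemma norm_eta_le k :
  `|eta k.+1| <= err k * beta k * Num.sqrt (delta k.+1 / beta k.+1).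
Proof. by apply: norm_error_le => //; rewrite le_max lexx orbT. Qed.

(** The weighted distance [d_k] of the overview. *)
Definition scaled_dist a b k : R :=
  Num.sqrt (alpha k / beta k) * `|x k - a|
  + Num.sqrt (delta k / beta k) * `|y k - b|.

(** This is [gap_step] divided by [beta k]. The growth conditions give [(1 + beta k) alpha k.+1 /
    beta k.+1 <= alpha k], and likewise for [delta], so the new distances also gain the factor
    [1 + beta k]. The primal and dual errors each contribute half of the last term. *)
Lemma renergy_step k a b : fin k -> f a \is a fin_num -> g b \is a fin_num ->
  (1 + 1 / beta k) * renergy a b k.+1 <= renergy a b k
    + scaled_dist a b k.+1 * err k
    + err k ^+ 2 * beta k ^+ 2 / (2 * theta * (1 + beta k)).
Proof.
move=> fk fa gb; have b0 := beta0 k; have /andP[th0 _] := theta01.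
have := gap_step fk fa gb.
have sx := sqr_step_ratio (alpha0 k) (alpha0 k.+1) (beta0 k.+1) (alphaS k).
have sy := sqr_step_ratio (delta0 k) (delta0 k.+1) (beta0 k.+1) (deltaS k).
have := inner_error_le (x k.+1 - a) (x k.+1 - x k) th0 b0 (error_ratio_ge0 k)
  (ltW (alpha0 k)) (sqrtr_ge0 _) sx (norm_eps_le k).
have := inner_error_le (y k.+1 - b) (y k.+1 - y k) th0 b0 (error_ratio_ge0 k)
  (ltW (delta0 k)) (sqrtr_ge0 _) sy (norm_eta_le k).
have := ler_wpM2r (sqr_ge0 `|x k.+1 - a|) sx.
have := ler_wpM2r (sqr_ge0 `|y k.+1 - b|) sy.
rewrite !sqr_sqrtr ?divr_ge0 ?(ltW (alpha0 _)) ?(ltW (delta0 _)) ?(ltW (beta0 _))//.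
rewrite /renergy /scaled_dist.
move: (rgap a b k.+1) (rgap a b k) => D1 D0.
move: (Num.sqrt _ * `|x k.+1 - a|) (Num.sqrt _ * `|y k.+1 - b|) => p q.
move: (`|x k.+1 - a| ^+ 2) (`|y k.+1 - b| ^+ 2) (`|x k - a| ^+ 2) (`|y k - b| ^+ 2).
move: (`|x k.+1 - x k| ^+ 2) (`|y k.+1 - y k| ^+ 2) => d e u v u0 v0.
move: '<_, _> '<_, _> => i j.
have -> : err k ^+ 2 * beta k ^+ 2 / (2 * theta * (1 + beta k)) =
  2 * (err k ^+ 2 * beta k ^+ 2 / (4 * (theta * (1 + beta k)))).
  by field; rewrite !gt_eqF ?addr_gt0.
move: (err k) (_ / (4 * _)) => r w h1 h2 h3 h4 h5.
rewrite -(ler_pM2l b0).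
have -> : beta k * ((1 + 1 / beta k) * (D1 + (alpha k.+1 / beta k.+1 / 2 * u
    + delta k.+1 / beta k.+1 / 2 * v))) = (1 + beta k) * (D1
    + (alpha k.+1 / beta k.+1 / 2 * u + delta k.+1 / beta k.+1 / 2 * v)).
  by field; rewrite !gt_eqF.
have -> : beta k * (D0 + (alpha k / beta k / 2 * u0 + delta k / beta k / 2 * v0)
    + (p + q) * r + 2 * w) = beta k * D0 + alpha k / 2 * u0 + delta k / 2 * v0
    + beta k * ((p + q) * r + 2 * w).
  by field; rewrite !gt_eqF.
move: h1 h2; move: (alpha k.+1 / beta k.+1) (delta k.+1 / beta k.+1) => t1 t2 h1 h2.
lra.
Qed.

Lemma renergy_weighted_step k a b : fin k -> f a \is a fin_num -> g b \is a fin_num ->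
  weight beta k.+1 ^+ 2 * renergy a b k.+1 <= weight beta k ^+ 2 * renergy a b k
    + weight beta k.+1 ^+ 2 * (scaled_dist a b k.+1 * (beta k * err k)
      + (beta k * err k) ^+ 2 / (2 * theta)).
Proof.
move=> fk fa gb; have /andP[th0 _] := theta01.
apply: weighted_energy_step => //; [|exact: error_ratio_ge0|exact: renergy_step].
by rewrite addr_ge0// mulr_ge0// sqrtr_ge0.
Qed.

Lemma rgap_le_renergy a b k : rgap a b k <= renergy a b k.
Proof.
rewrite lerDl addr_ge0// mulr_ge0 ?sqr_ge0// divr_ge0// divr_ge0// ltW//.
Qed.

(** Keeps the coefficients of [scaled_dist] bounded, so that changing the reference point changes
    the distance by at most a constant. *)
Lemma ratio_nonincreasing k :
  Num.sqrt (alpha k / beta k) <= Num.sqrt (alpha 0 / beta 0) /\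
  Num.sqrt (delta k / beta k) <= Num.sqrt (delta 0 / beta 0).
Proof.
have step (a a1 b b1 : R) : 0 < a -> 0 < a1 -> 0 < b -> 0 < b1 ->
    (1 + b) / a <= b1 / a1 -> Num.sqrt (a1 / b1) <= Num.sqrt (a / b).
  move=> a0 a10 b0 b10 h; rewrite ler_sqrt ?divr_ge0 ?(ltW a0) ?(ltW b0)//.
  rewrite -lef_pV2 ?posrE ?divr_gt0// !invf_div (le_trans _ h)//.
  by rewrite ler_pM2r ?invr_gt0// lerDr.
elim: k => // k [ha hd]; split; [apply: le_trans ha|apply: le_trans hd].
  exact: step (alphaS k).
exact: step (deltaS k).
Qed.

Lemma gapE a b k : fin k -> f a \is a fin_num -> g b \is a fin_num ->
  gap A (composite f F) (composite g G) a b x y k = (rgap a b k)%:E.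
Proof.
move=> [fx gy] fa gb.
by rewrite /gap /lagrangian /composite -(fineK fx) -(fineK gy) -(fineK fa)
  -(fineK gb).
Qed.

Lemma energyE a b k : fin k -> f a \is a fin_num -> g b \is a fin_num ->
  energy A (composite f F) (composite g G) alpha beta delta a b x y k =
  (renergy a b k)%:E.
Proof. by move=> *; rewrite /energy gapE. Qed.

(** * Energy estimates relative to a saddle point *)

Section Saddle.
Variables (xs : X) (ys : Y).
Hypothesis saddle : primal_dual_solutions A Astar f gradF g gradG (xs, ys).

Lemma saddle_fin : f xs \is a fin_num /\ g ys \is a fin_num.
Proof.
have [pf _ _] := pcl_f; have [pg _ _] := pcl_g.
have [[u fu _] [v gv _]] := saddle.
by split; [exact: subdiff_fin_num fu|exact: subdiff_fin_num gv].
Qed.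

Definition primal_gap z : R := Phi z - Phi xs + '<A (z - xs), ys>.
Definition dual_gap w : R := Gamma w - Gamma ys - '<A xs, w - ys>.

Lemma primal_gap_ge0 z : f z \is a fin_num -> 0 <= primal_gap z.
Proof.
move=> fz; have [fxs _] := saddle_fin; have [[u fu /= uE] _] := saddle.
have := subdiff_fine fxs fz fu; have := convex_smooth_ge csF xs z.
have : '<gradF xs + u, z - xs> = - '<A (z - xs), ys>.
  by rewrite -uE innerNl innerC -adjA.
rewrite /primal_gap /real_composite innerDl; lra.
Qed.

Lemma dual_gap_ge0 w : g w \is a fin_num -> 0 <= dual_gap w.
Proof.
move=> gw; have [_ gys] := saddle_fin; have [_ [v gv /= vE]] := saddle.
have := subdiff_fine gys gw gv; have := convex_smooth_ge csG ys w.
have : '<gradG ys + v, w - ys> = '<A xs, w - ys> by rewrite -vE.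
rewrite /dual_gap /real_composite innerDl; lra.
Qed.

Lemma rgap_split k : rgap xs ys k = primal_gap (x k) + dual_gap (y k).
Proof. rewrite /real_gap /primal_gap /dual_gap (raddfB A) !innerE; ring. Qed.

Lemma rgap_ge0 k : fin k -> 0 <= rgap xs ys k.
Proof.
by move=> [fx gy]; rewrite rgap_split addr_ge0 ?primal_gap_ge0 ?dual_gap_ge0.
Qed.

Lemma renergy_ge0 k : fin k -> 0 <= renergy xs ys k.
Proof. by move=> fk; apply: le_trans (rgap_le_renergy _ _ _); exact: rgap_ge0. Qed.

(** With [p], [q] the two summands, the energy is the gap plus [(p ^ 2 + q ^ 2) / 2]. The gap is
    nonnegative at a saddle point, so [(p + q) ^ 2 <= 2 (p ^ 2 + q ^ 2)] is at most four times the
    energy. *)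
Lemma scaled_dist_le k : fin k ->
  scaled_dist xs ys k <= 2 * Num.sqrt (renergy xs ys k).
Proof.
move=> fk; have := rgap_ge0 fk.
have e0 := renergy_ge0 fk.
have := sqrtr_ge0 (renergy xs ys k); have := sqr_sqrtr e0.
rewrite {2}/renergy /scaled_dist.
have := sqr_sqrtr (ltW (divr_gt0 (alpha0 k) (beta0 k))).
have := sqr_sqrtr (ltW (divr_gt0 (delta0 k) (beta0 k))).
move: (Num.sqrt (renergy _ _ _)) (rgap _ _ _) => e d.
move: (Num.sqrt (alpha k / beta k)) (Num.sqrt (delta k / beta k)) => s t <- <-.
move: `|x k - xs| `|y k - ys| => u v he e1 d0.
have {he} : e ^+ 2 = d + ((s * u) ^+ 2 + (t * v) ^+ 2) / 2 by rewrite he; field.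
move: (s * u) (t * v) => p q he.
rewrite leNgt; apply/negP => h.
have : (2 * e) ^+ 2 < (p + q) ^+ 2.
  by rewrite [ltLHS]expr2 [ltRHS]expr2 ltr_pM ?mulr_ge0.
have := sqr_ge0 (p - q); rewrite !exprMn; nra.
Qed.

Local Notation rate := (1 + Num.sqrt (1 + 1 / (2 * theta))).

(** The start [m] is 0 for the explicit bound and 1, where finiteness always holds, for the
    asymptotic statements. *)
Lemma sqrt_renergy_le m k : fin m -> (m <= k)%N ->
  weight beta k * Num.sqrt (renergy xs ys k) <=
  weight beta m * Num.sqrt (renergy xs ys m)
    + rate * \sum_(j < k) beta j * weight beta j.+1 * err j.
Proof.
move=> fm mk; rewrite mulr_sumr; have /andP[th0 _] := theta01.
have [fxs gys] := saddle_fin.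
pose e k := weight beta k * Num.sqrt (renergy xs ys k).
pose s j := rate * (beta j * weight beta j.+1 * err j).
apply: (@ler_add_telescope _ e s) => // [j|j mj].
  apply: mulr_ge0; first by rewrite addr_ge0 ?sqrtr_ge0.
  apply: mulr_ge0 (error_ratio_ge0 j).
  by rewrite mulr_ge0// ltW// weight_gt0.
have fj := fin_from fm mj; have fj1 := fin_from fm (leqW mj).
apply: sqrt_energy_step => //; [exact: renergy_ge0..|exact: error_ratio_ge0|].
apply: le_trans (renergy_step fj fxs gys) _.
by rewrite lerD2r lerD2l ler_wpM2r ?error_ratio_ge0// scaled_dist_le.
Qed.

Local Notation Delta := (gap A (composite f F) (composite g G) xs ys x y).
Local Notation E :=
  (energy A (composite f F) (composite g G) alpha beta delta xs ys x y).

(** * Convergence when the weights diverge and the errors are summable *)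

Section Convergence.
Hypothesis beta_not_ell1 : ~ ell1 (fun k => 1 / beta k).
Hypothesis error_ell1 : ell1 (fun k => beta k * err k).

Lemma berr_ge0 k : 0 <= beta k * err k.
Proof. by rewrite mulr_ge0 ?error_ratio_ge0// ltW. Qed.

Lemma renergy_small e : 0 < e ->
  exists N, forall k, (N <= k)%N -> renergy xs ys k <= e.
Proof.
move=> e0; pose rt : R := rate.
have rt0 : 0 <= rt by rewrite addr_ge0 ?sqrtr_ge0.
have f1 : fin 1 by exact: iterate_fin.
have uw k : (1 <= k)%N -> Num.sqrt (renergy xs ys k) * weight beta k <=
    weight beta 1 * Num.sqrt (renergy xs ys 1)
    + \sum_(j < k) weight beta j.+1 * `|rt * (beta j * err j)|.
  move=> k1; rewrite mulrC; apply: le_trans (sqrt_renergy_le f1 k1) _.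
  rewrite lerD2l mulr_sumr le_eqVlt; apply/orP; left; apply/eqP.
  apply: eq_bigr => j _; rewrite (ger0_norm (mulr_ge0 rt0 (berr_ge0 j))) -/rt.
  ring.
have sqe0 : 0 < Num.sqrt e by rewrite sqrtr_gt0.
have [N hN] := weighted_sum_le (weight_gt0 beta0) (weight_nondecreasing beta0)
  (weight_unbounded beta0 beta_not_ell1) (@ell1Z _ _ rt error_ell1) uw sqe0.
exists N => k /hN.
by rewrite ler_sqrt// ltW.
Qed.

(** Once the energy at the saddle point is at most 1, the scaled distance to it is at most 2; the
    triangle inequality moves the reference point to [(a, b)]. *)
Lemma scaled_dist_bounded a b : exists Q N,
  [/\ 0 <= Q, (1 <= N)%N & forall k, (N <= k)%N -> scaled_dist a b k <= Q].
Proof.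
have [N hN] := renergy_small (ltr01 : 0 < 1 :> R).
pose Q := 2 + Num.sqrt (alpha 0 / beta 0) * `|xs - a|
  + Num.sqrt (delta 0 / beta 0) * `|ys - b|.
exists Q, N.+1; split=> //.
  by rewrite !addr_ge0// mulr_ge0// sqrtr_ge0.
move=> k Nk; have fk : fin k by apply: iterate_fin; apply: leq_trans Nk.
have [ha hd] := ratio_nonincreasing k.
have := scaled_dist_le fk.
have : Num.sqrt (renergy xs ys k) <= 1.
  by rewrite -sqrtr1 ler_wsqrtr// hN// ltnW.
have tri (Z : hilbertType R) (c c0 : R) (z w v : Z) : 0 <= c -> c <= c0 ->
    c * `|z - v| <= c * `|z - w| + c0 * `|w - v|.
  move=> c1 cc; apply: le_trans (_ : c * (`|z - w| + `|w - v|) <= _).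
    by rewrite ler_wpM2l// ler_distD.
  by rewrite mulrDr lerD2l ler_wpM2r.
have := tri _ _ _ (x k) xs a (sqrtr_ge0 _) ha.
have := tri _ _ _ (y k) ys b (sqrtr_ge0 _) hd.
rewrite /Q /scaled_dist; lra.
Qed.

(** Away from a saddle point the energy may be negative, so no square root is taken: the recursion
    runs on the energy itself with squared weights. If [scaled_dist] is at most [Q] and
    [beta k * err k] at most [M], each step costs at most [c = Q + M / (2 theta)] times the summable
    error, and the Kronecker-type lemma applies. *)
Lemma renergy_limsup_le0 a b : f a \is a fin_num -> g b \is a fin_num ->
  forall e, 0 < e -> exists N, forall k, (N <= k)%N -> renergy a b k <= e.
Proof.
move=> fa gb; have [Q [N [Q0 N1 hQ]]] := scaled_dist_bounded a b.
have /andP[th0 _] := theta01.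
have [M hM] := ell1_term_bounded error_ell1.
have M0 : 0 <= M by exact: le_trans (hM 0).
pose c := Q + M / (2 * theta).
have c0 : 0 <= c by rewrite addr_ge0 ?divr_ge0 ?mulr_ge0 ?(ltW th0).
apply: (@weighted_sum_le _ (fun k => weight beta k ^+ 2)
  (fun k => c * (beta k * err k)) (fun k => renergy a b k)
  (weight beta N ^+ 2 * renergy a b N) N).
- by move=> k; rewrite exprn_gt0// weight_gt0.
- move=> i j ij; rewrite lerXn2r ?nnegrE ?(ltW (weight_gt0 _ _))//.
  exact: weight_nondecreasing.
- exact: sqr_weight_unbounded.
- exact: ell1Z.
move=> k Nk; rewrite mulrC.
pose s j := weight beta j.+1 ^+ 2 * `|c * (beta j * err j)|.
apply: (@ler_add_telescope _ (fun k => weight beta k ^+ 2 * renergy a b k) s) => //.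
  by move=> j; rewrite mulr_ge0 ?sqr_ge0.
move=> j Nj; have fj : fin j by apply: iterate_fin; exact: leq_trans Nj.
apply: le_trans (renergy_weighted_step fj fa gb) _.
rewrite lerD2l ler_wpM2l ?sqr_ge0// (ger0_norm (mulr_ge0 c0 (berr_ge0 j))).
rewrite /c [leRHS]mulrDl lerD//; first by rewrite ler_wpM2r ?berr_ge0// hQ// leqW.
rewrite [leRHS]mulrAC ler_wpM2r ?invr_ge0 ?mulr_ge0 ?(ltW th0)// expr2.
by rewrite ler_wpM2r ?berr_ge0// -(ger0_norm (berr_ge0 j)).
Qed.

Lemma gap_energy_cvg0 :
  (Delta k @[k --> \oo] --> 0%E) /\ (E k @[k --> \oo] --> 0%E).
Proof.
have [fxs gys] := saddle_fin.
split.
- apply: (@cvge0_of_small _ _ (rgap xs ys)) => [k k1|k k1|e e0].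
  + by rewrite gapE//; exact: iterate_fin.
  + by apply: rgap_ge0; exact: iterate_fin.
  have [N hN] := renergy_small e0; exists N => k /hN.
  exact: le_trans (rgap_le_renergy _ _ _).
- apply: (@cvge0_of_small _ _ (renergy xs ys)) => [k k1|k k1|e e0].
  + by rewrite energyE//; exact: iterate_fin.
  + by apply: renergy_ge0; exact: iterate_fin.
  exact: renergy_small.
Qed.

Lemma weak_limits_solutions :
  weak_subseq_limit x y `<=` primal_dual_solutions A Astar f gradF g gradG.
Proof.
move=> [xh yh] [phi [phi_inc xw yw]]; rewrite /= in xw yw.
have [fxs gys] := saddle_fin.
have phi_ge n : (n <= phi n)%N.
  by elim: n => // n IHn; apply: leq_ltn_trans IHn _; exact: phi_inc.
(* The shift drops a possible index 0, so that every iterate of the subsequence has finite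
   values. *)
pose sh n := phi n.+1.
have sh_ge n : (n < sh n)%N by exact: phi_ge.
have shift (Z : hilbertType R) (u : nat -> Z) l :
    weak_cvg (u \o phi) l -> weak_cvg (u \o sh) l.
  by move=> uw v; have := uw v; rewrite -(cvg_shiftS (fun n => '<v, (u \o phi) n>)).
apply: (weak_limit_solution adjA pcl_f pcl_g LF0 csF LG0 csG _
  (shift _ _ _ xw) (shift _ _ _ yw) _ fxs gys) => [k|a b fa gb e e0].
  by apply: iterate_fin; exact: leq_ltn_trans (sh_ge k).
have [N hN] := renergy_limsup_le0 fa gb e0.
exists N => // k /= Nk; apply: le_trans (hN (sh k) _).
  exact: rgap_le_renergy.
by apply: ltnW; exact: leq_ltn_trans (sh_ge k).
Qed.

End Convergence.

Lemma sqrt_energy_bound k :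
  (sqrte (E k.+1) <= (1 / Bcoef beta k)%:E *
    (sqrte (E 0%N)
     + (rate * \sum_(j < k.+1) beta j * Bcoef beta j * err j)%:E))%E.
Proof.
have [fxs gys] := saddle_fin.
have B0 : 0 < Bcoef beta k by exact: (weight_gt0 beta0 k.+1).
have [pf _ _] := pcl_f; have [pg _ _] := pcl_g.
have [[fx gy]|nfin] := pselect (fin 0).
  have := sqrt_renergy_le (conj fx gy) (leq0n k.+1).
  rewrite {2}/weight big_ord0 [1 * Num.sqrt (renergy _ _ _)]mul1r.
  rewrite !energyE//; last exact: iterate_fin.
  rewrite /= -EFinD -EFinM lee_fin [1 / Bcoef _ _]mul1r => h.
  by rewrite [leRHS]mulrC ler_pdivlMr// [leLHS]mulrC.
(* An infinite value at the starting point makes the first Lagrangian value [+oo] or the second one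
   [-oo]. Their difference is [+oo] in every case, and the bound becomes trivial. *)
have -> : E 0 = +oo%E.
  have [fNy _] := pf; have [gNy _] := pg.
  rewrite /energy /gap /lagrangian /composite -(fineK fxs) -(fineK gys).
  case: (f (x 0)) (fNy (x 0)) nfin => [r _ nfin|_ _|//]; last first.
    by case: (g (y 0)) (gNy (y 0)).
  by case: (g (y 0)) (gNy (y 0)) nfin => [s _ []|_ _|].
by rewrite /= gt0_muley ?leey// lte_fin divr_gt0.
Qed.

Lemma gap_le_energy k : (Delta k <= E k)%E.
Proof.
by rewrite leeDl// lee_fin addr_ge0// mulr_ge0 ?sqr_ge0// divr_ge0// divr_ge0// ltW.
Qed.

(** From index 1 on, both components are nonnegative and sum to the gap, so the constant 1
    suffices. *)
Lemma gap_components_bigO :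
  ebigO (fun k => composite f F (x k) - composite f F xs + '<A (x k - xs), ys>%:E)%E
    Delta /\
  ebigO (fun k => composite g G (y k) - composite g G ys - '<A xs, y k - ys>%:E)%E
    Delta.
Proof.
have [fxs gys] := saddle_fin.
have gaps k : (1 <= k)%N -> 0 <= primal_gap (x k) /\ 0 <= dual_gap (y k).
  by move=> /iterate_fin[fx gy]; split; [exact: primal_gap_ge0|exact: dual_gap_ge0].
split; exists 1; exists 1%N => // k /= k1.
- have [fx _] := iterate_fin k1; have [p0 d0] := gaps k k1.
  rewrite gapE//; last exact: iterate_fin.
  rewrite rgap_split mul1e /composite -(fineK fx) -(fineK fxs).
  rewrite -[leLHS]/((`|primal_gap (x k)|)%:E) lee_fin.
  by rewrite (ger0_norm p0) (ger0_norm (addr_ge0 p0 d0)) lerDl.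
- have [_ gy] := iterate_fin k1; have [p0 d0] := gaps k k1.
  rewrite gapE//; last exact: iterate_fin.
  rewrite rgap_split mul1e /composite -(fineK gy) -(fineK gys).
  rewrite -[leLHS]/((`|dual_gap (y k)|)%:E) lee_fin.
  by rewrite (ger0_norm d0) (ger0_norm (addr_ge0 p0 d0)) lerDr.
Qed.

(** * Rates under weighted summability of the errors *)

Section Rate.
Hypothesis weighted_error_ell1 : ell1 (fun k => beta k * Bcoef beta k * err k).

Lemma weighted_renergy_bounded : exists C, 0 <= C /\
  forall k, (1 <= k)%N -> weight beta k ^+ 2 * renergy xs ys k <= C.
Proof.
have f1 : fin 1 by exact: iterate_fin.
have [M hM] := ell1_bounded weighted_error_ell1.
exists ((weight beta 1 * Num.sqrt (renergy xs ys 1) + rate * M) ^+ 2).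
split=> [|k k1]; first exact: sqr_ge0.
have fk : fin k by exact: iterate_fin.
rewrite -{1}(sqr_sqrtr (renergy_ge0 fk)) -exprMn.
have h : weight beta k * Num.sqrt (renergy xs ys k) <=
    weight beta 1 * Num.sqrt (renergy xs ys 1) + rate * M.
  apply: le_trans (sqrt_renergy_le f1 k1) _.
  rewrite lerD2l ler_wpM2l ?addr_ge0 ?sqrtr_ge0//.
  by apply: le_trans (hM k); apply: ler_sum => j _; exact: ler_norm.
have h0 : 0 <= weight beta k * Num.sqrt (renergy xs ys k).
  by rewrite mulr_ge0 ?sqrtr_ge0 ?(ltW (weight_gt0 _ _)).
by rewrite !expr2; exact: ler_pM.
Qed.

Lemma energyS_bigO : ebigO (fun k => E k.+1) (fun k => (1 / Bcoef beta k ^+ 2)%:E).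
Proof.
have [fxs gys] := saddle_fin.
have [C [C0 hC]] := weighted_renergy_bounded.
exists C; apply: nearW => k; have fk : fin k.+1 by exact: iterate_fin.
have B20 : 0 < Bcoef beta k ^+ 2 by rewrite exprn_gt0 ?(weight_gt0 beta0 k.+1).
rewrite energyE//= lee_fin !ger0_norm ?renergy_ge0//; last by rewrite divr_ge0 ?ltW.
by rewrite mulrA mulr1 ler_pdivlMr// mulrC; exact: (hC k.+1).
Qed.

(** The recursion bounds the energy at [k] by the inverse square of [weight k], which is [B_(k-1)].
    Passing to [B_k] costs the factor [1 + 1 / beta k], bounded by [1 + 1 / b]. *)
Lemma energy_bigO b : 0 < b -> (forall k, b <= beta k) ->
  ebigO E (fun k => (1 / Bcoef beta k ^+ 2)%:E).
Proof.
move=> b0 hb; have [fxs gys] := saddle_fin.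
have [C [C0 hC]] := weighted_renergy_bounded.
exists (C * (1 + 1 / b)); exists 1%N => // k /= k1.
have fk : fin k by exact: iterate_fin.
have B20 : 0 < Bcoef beta k ^+ 2 by rewrite exprn_gt0 ?(weight_gt0 beta0 k.+1).
rewrite energyE//= lee_fin !ger0_norm ?renergy_ge0//; last by rewrite divr_ge0 ?ltW.
rewrite mulrA mulr1 ler_pdivlMr// -[Bcoef beta k]/(weight beta k.+1) sqr_weightS//.
rewrite mulrA; apply: ler_pM.
- by rewrite mulr_ge0 ?renergy_ge0 ?sqr_ge0.
- by rewrite ltW// (lt_trans ltr01) ?factor_gt1.
- by rewrite mulrC hC.
- by rewrite lerD2l !div1r lef_pV2 ?posrE.
Qed.

End Rate.

Lemma error_ell1_of_weighted :
  ell1 (fun k => beta k * Bcoef beta k * err k) -> ell1 (fun k => beta k * err k).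
Proof.
apply: ell1_le => k; rewrite mulrAC [leRHS]normrM ler_peMr//.
apply: le_trans (ler_norm _); exact: (weight_ge1 beta0 k.+1).
Qed.

End Saddle.

End Algorithm.

(** Since [(b k + 1) / (2 b k + 1) >= 1 / 2] and [1 - theta < 1], the step-size condition forces
    [a k >= L / 2]; as [b k / a k] is nondecreasing, [b k] is at least [(b 0 / a 0) (L / 2)]. *)
Lemma ratio_ge {R : realType} (a b : nat -> R) (L theta : R) :
  (forall k, 0 < a k) -> (forall k, 0 < b k) -> 0 < theta < 1 -> 0 < L ->
  (forall k, (1 - theta) * a k >= (b k + 1) * L / (2 * b k + 1)) ->
  (forall k, b k.+1 / a k.+1 >= (1 + b k) / a k) ->
  exists2 c, 0 < c & forall k, c <= b k.
Proof.
move=> a0 b0 /andP[th0 th1] L0 aL aS.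
have ha k : L / 2 <= a k.
  have := aL k; have := a0 k; have := b0 k => bk ak.
  have c0 : 0 < 2 * b k + 1 by lra.
  rewrite ler_pdivrMr// => h.
  have : (1 - theta) * a k * (2 * b k + 1) <= a k * (2 * b k + 1).
    by rewrite ler_pM2r//; nra.
  rewrite -(ler_pM2r c0); nra.
have hr k : b 0 / a 0 <= b k / a k.
  elim: k => // k /le_trans; apply; apply: le_trans (aS k).
  by rewrite ler_pM2r ?invr_gt0// lerDr.
exists (b 0 / a 0 * (L / 2)); first by rewrite !mulr_gt0 ?invr_gt0.
move=> k; have := hr k; rewrite ler_pdivlMr//; apply: le_trans.
by rewrite ler_wpM2l// divr_ge0// ltW.
Qed.

Unset Implicit Arguments.

(** The rate is given for the energy at [k.+1], and at [k] when [beta] is bounded below, which a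
    positive [LF] or [LG] ensures. The clause on weak limits carries the hypotheses under which the
    energy is shown to vanish. *)
Theorem theorem5 (R : realType) (X Y : hilbertType R)
    (A : {linear X -> Y}) (Astar : Y -> X)
    (f : X -> \bar R) (F : X -> R) (gradF : X -> X) (LF : R)
    (g : Y -> \bar R) (G : Y -> R) (gradG : Y -> Y) (LG : R)
    (alpha beta delta : nat -> R) (theta : R)
    (eps : nat -> X) (eta : nat -> Y)
    (xs : X) (ys : Y) (x : nat -> X) (y : nat -> Y) :
  bounded_near A (nbhs (0 : X)) ->
  adjoint_of A Astar ->
  proper_convex_lsc f -> proper_convex_lsc g ->
  0 <= LF -> convex_smooth LF F gradF ->
  0 <= LG -> convex_smooth LG G gradG ->
  let S := primal_dual_solutions A Astar f gradF g gradG in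
  S (xs, ys) ->
  (forall k, exists2 u, subdiff f (x k.+1) u &
     alpha k *: (x k.+1 - x k) + beta k *: Astar (y k.+1 - y k)
     + u + gradF (x k) + Astar (y k.+1) = eps k.+1) ->
  (forall k, exists2 v, subdiff g (y k.+1) v &
     - (beta k *: A (x k.+1 - x k)) + delta k *: (y k.+1 - y k)
     - A (x k.+1) + v + gradG (y k) = eta k.+1) ->
  (forall k, 0 < alpha k) -> (forall k, 0 < beta k) ->
  (forall k, 0 < delta k) ->
  0 < theta < 1 ->
  (forall k, (1 - theta) * alpha k >= (beta k + 1) * LF / (2 * beta k + 1)) ->
  (forall k, (1 - theta) * delta k >= (beta k + 1) * LG / (2 * beta k + 1)) ->
  (forall k, beta k.+1 / alpha k.+1 >= (1 + beta k) / alpha k) ->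
  (forall k, beta k.+1 / delta k.+1 >= (1 + beta k) / delta k) ->
  let Phi := composite f F in
  let Gamma := composite g G in
  let Delta := gap A Phi Gamma xs ys x y in
  let E := energy A Phi Gamma alpha beta delta xs ys x y in
  let B := Bcoef beta in
  let Rk := error_ratio alpha beta delta eps eta in
  [/\ (forall k, (sqrte (E k.+1) <= (1 / B k)%:E *
         (sqrte (E 0%N)
          + ((1 + Num.sqrt (1 + 1 / (2 * theta)))
             * \sum_(j < k.+1) beta j * B j * Rk j)%:E))%E),
      (~ ell1 (fun k => 1 / beta k) -> ell1 (fun k => beta k * Rk k) ->
         (Delta k @[k --> \oo] --> 0%E) /\ (E k @[k --> \oo] --> 0%E)),
      (ell1 (fun k => beta k * B k * Rk k) ->
         [/\ (forall k, (Delta k <= E k)%E),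
             ebigO (fun k => E k.+1) (fun k => (1 / B k ^+ 2)%:E) &
             ([\/ 0 < LF, 0 < LG | exists2 b, 0 < b & forall k, b <= beta k] ->
              ebigO E (fun k => (1 / B k ^+ 2)%:E))]),
      (ebigO (fun k => (Phi (x k) - Phi xs + '<A (x k - xs), ys>%:E)%E) Delta /\
       ebigO (fun k => (Gamma (y k) - Gamma ys - '<A xs, y k - ys>%:E)%E) Delta) &
      (~ ell1 (fun k => 1 / beta k) ->
       ell1 (fun k => beta k * Rk k) \/ ell1 (fun k => beta k * B k * Rk k) ->
       weak_subseq_limit x y `<=` S)].
Proof.
move=> _ adjA pf pg LF0 csF LG0 csG S sol stepx stepy al0 be0 de0 th alphaL deltaL
  alphaS deltaS Phi Gamma Delta E B Rk.
split.
- exact: (sqrt_energy_bound adjA pf pg LF0 csF LG0 csG stepx stepy al0 be0 de0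
    th alphaL deltaL alphaS deltaS sol).
- exact: (gap_energy_cvg0 adjA pf pg LF0 csF LG0 csG stepx stepy al0 be0 de0
    th alphaL deltaL alphaS deltaS sol).
- move=> wer; split.
  + by move=> k; exact: gap_le_energy.
  + exact: (energyS_bigO adjA pf pg LF0 csF LG0 csG stepx stepy al0 be0 de0
    th alphaL deltaL alphaS deltaS sol wer).
  move=> bL; have [b b0 hb] : exists2 b, 0 < b & forall k, b <= beta k.
    case: bL => // L0; first exact: (ratio_ge al0 be0 th L0 alphaL alphaS).
    exact: (ratio_ge de0 be0 th L0 deltaL deltaS).
  exact: (energy_bigO adjA pf pg LF0 csF LG0 csG stepx stepy al0 be0 de0
    th alphaL deltaL alphaS deltaS sol wer b0 hb).
- exact: (gap_components_bigO adjA pf pg csF csG stepx stepy sol).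
- move=> nb er; apply: (weak_limits_solutions adjA pf pg LF0 csF LG0 csG stepx stepy al0 be0 de0
    th alphaL deltaL alphaS deltaS sol nb).
  (* As [B_k >= 1], weighted summability of the errors implies plain summability. *)
  by case: er => //; exact: error_ell1_of_weighted.
Qed.
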